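(* Let $H$ and $D$ be measurable spaces with countably generated $\sigma$-algebras $\Sigma_H$ and $\Sigma_D$. Let $P_H\colon 1\to H$ be a $\mathcal{P}$-arrow (a perfect probability measure on $H$, the prior probability) and let $\mathcal{S}\colon H\to D$ be a $\mathcal{P}$-arrow (the sampling distribution). Put $P_D=\mathcal{S}\circ P_H$, i.e. $P_D(B)=\int_H \mathcal{S}_B\,dP_H$ for $B\in\Sigma_D$. Then there exists an inference map for $(P_H,\mathcal{S})$, that is, a $\mathcal{P}$-arrow $\mathcal{I}\colon D\to H$ such that $$\int_A \mathcal{S}_B\,dP_H=\int_B \mathcal{I}_A\,dP_D\qquad\text{for all }A\in\Sigma_H,\ B\in\Sigma_D,$$ and it is unique up to a set of $P_D$-measure zero: if $\mathcal{I}'\colon D\to H$ is another $\mathcal{P}$-arrow satisfying the same identity for all $A\in\Sigma_H$, $B\in\Sigma_D$, then the set $\{y\in D \mid \mathcal{I}_y\neq\mathcal{I}'_y\}$ has $P_D$-measure zero.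
   Context: Perfect measures: a measure space $(X,\Sigma,\mu)$ (or the measure $\mu$) is called perfect if for every measurable function $f\colon X\to\mathbb{R}$ there is a Borel set $E\subset f(X)$ with $\mu(f^{-1}(E))=\mu(X)$. A family $\{\mu_i\}_{i\in I}$ of measures on $X$ is called equiperfect if for every measurable $f\colon X\to\mathbb{R}$ there is a single Borel set $E\subset f(X)$ with $\mu_i(f^{-1}(E))=\mu_i(X)$ for all $i\in I$. The category $\mathcal{P}$ of perfect probabilistic mappings: objects are measurable spaces $(X,\Sigma_X)$ with countably generated $\sigma$-algebra. An arrow ($\mathcal{P}$-arrow, or $\mathcal{P}$-morphism) $f\colon (X,\Sigma_X)\to(Y,\Sigma_Y)$ is a function $f\colon X\times\Sigma_Y\to[0,1]$ such that (i) for every $B\in\Sigma_Y$ the function $f_B:=f(\cdot,B)\colon X\to[0,1]$ is measurable, and (ii) the family $\{f_x:=f(x,\cdot)\}_{x\in X}$ is an equiperfect family of probability measures on $Y$. The composite of $f\colon X\to Y$ and $g\colon Y\to Z$ is $(g\circ f)(x,C)=\int_{Y} g_C\,df_x$ for $x\in X$, $C\in\Sigma_Z$. The object $1$ is the one-point measurable space; a $\mathcal{P}$-arrow $1\to X$ is the same thing as a perfect probability measure on $X$. An inference map for a prior $P_H$ and a sampling distribution $\mathcal{S}$ is a $\mathcal{P}$-arrow $\mathcal{I}\colon D\to H$ satisfying the product rule $\int_A \mathcal{S}_B\,dP_H=\int_B\mathcal{I}_A\,dP_D$ for all $A\in\Sigma_H$, $B\in\Sigma_D$. *)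

(* Defs.v *)
From HB Require Import structures.
From mathcomp Require Import all_boot all_order all_algebra.
From mathcomp Require Import all_classical all_reals all_analysis.

Set Implicit Arguments.
Unset Strict Implicit.
Unset Printing Implicit Defensive.
Import Order.TTheory GRing.Theory Num.Theory.
Import numFieldNormedType.Exports.

Local Open Scope classical_set_scope.
Local Open Scope ring_scope.
Local Open Scope ereal_scope.

Definition countably_generated (d : measure_display) (X : measurableType d) :=
  exists G : set (set X), countable G /\ @measurable d X = <<s G >>.

(* [measurable E] refers to the Borel sigma-algebra of [R]. *)
Definition equiperfect (d : measure_display) (X : measurableType d)
    (R : realType) (I : Type) (mu : I -> {measure set X -> \bar R}) :=
  forall f : X -> R, measurable_fun setT f ->
    exists E : set R, [/\ measurable E, E `<=` range f &
      forall i, mu i (f @^-1` E) = mu i setT].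

(* A one-member equiperfect family is a perfect measure, so a perfect arrow
   out of [unit] is a perfect probability measure. *)
Record perfect_arrow (R : realType) (d d' : measure_display)
    (X : measurableType d) (Y : measurableType d') := PerfectArrow {
  arrow_kernel :> R.-pker X ~> Y;
  arrow_equiperfect : equiperfect arrow_kernel }.

Section composition.
Context (R : realType) (d0 d1 d2 : measure_display) (X : measurableType d0)
  (Y : measurableType d1) (Z : measurableType d2).
Variables (f : perfect_arrow R X Y) (g : perfect_arrow R Y Z).

Lemma mkcomp_noparam_full (C : set Z) : (forall y, g y C = 1) ->
  forall x, mkcomp_noparam f g x C = 1.
Proof.
move=> gC x.
transitivity (\int[f x]__ 1); first by apply: eq_integral => y _; exact: gC.
by rewrite integral_cst// mul1e prob_kernel.
Qed.

Let comp_prob x : mkcomp_noparam f g x setT = 1.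
Proof. by apply: mkcomp_noparam_full => y; exact: prob_kernel. Qed.

HB.instance Definition _ := Kernel_isProbability.Build
  _ _ _ _ R (mkcomp_noparam f g) comp_prob.

Lemma mkcomp_noparam_equiperfect : equiperfect (mkcomp_noparam f g).
Proof.
move=> h /(arrow_equiperfect g)[E [mE Eh gE]]; exists E; split => // x.
by rewrite comp_prob mkcomp_noparam_full// => y; rewrite gE prob_kernel.
Qed.

(* Diagrammatic order: this is g after f, with
   [perfect_comp f g x C = \int[f x]_y g y C]. *)
Definition perfect_comp : perfect_arrow R X Z :=
  @PerfectArrow R _ _ X Z (mkcomp_noparam f g) mkcomp_noparam_equiperfect.

End composition.

Definition inference_map (R : realType) (dH dD : measure_display)
    (H : measurableType dH) (D : measurableType dD)
    (PH : perfect_arrow R unit H) (S : perfect_arrow R H D)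
    (I : perfect_arrow R D H) :=
  forall (A : set H) (B : set D), measurable A -> measurable B ->
    \int[PH tt]_(x in A) S x B = \int[perfect_comp PH S tt]_(y in B) I y A.

(* Library measures are total on [set X], with unconstrained values outside the
   sigma-algebra; as measures in the usual sense they are compared on
   measurable sets only. *)
Definition eq_on_measurable (R : realType) (d : measure_display)
    (X : measurableType d) (mu nu : {measure set X -> \bar R}) :=
  forall A, measurable A -> mu A = nu A.

(* Main.v *)
(** Write [P] for the prior, [Q] for [P_D] and [m C = \int_H S_x (C_x) dP] for
    the joint measure on [H * D].

    If [m] has a density [f] with respect to [P \x Q], then normalizing
    [A |-> \int_A f (x, y) dP] gives an inference map, every member of which is
    absolutely continuous with respect to [P]; equiperfectness is then inherited
    from the single perfect measure [P].

    Equiperfectness of [S] is strong enough to force [m << P \x Q].  Suppose that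
    [N] is [P \x Q]-null and [m N > 0].  Almost every section [N_x] is [Q]-null
    although the [S_x N_x] are not all negligible, so a set of points [x] and a
    set of [D] can be split repeatedly into two halves, the halves in [D] being
    disjoint and keeping a fixed amount of [S_x N_x].  Perfectness of [P] supplies
    the compactness needed to pass to the limit along branches: there is a
    measurable [h : D -> 2^N] such that every fibre of [h] is charged by some
    [S_x].  Composing [h] with a Borel map of [2^N] whose range is not Borel
    (Suslin) gives [f : D -> R] for which a Borel set [E] inside [f(D)] with
    [S_x (f^-1 E) = 1] for all [x] would have to be that non-Borel range. *)

Require Import Defs.
From HB Require Import structures.
From mathcomp Require Import all_boot all_order all_algebra.
From mathcomp Require Import all_classical all_reals all_analysis.
From mathcomp Require Import measurable_realfun.
From mathcomp Require Import ring lra.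

Set Implicit Arguments.
Unset Strict Implicit.
Unset Printing Implicit Defensive.
Import Order.TTheory GRing.Theory Num.Theory.
Import numFieldNormedType.Exports.

Local Open Scope classical_set_scope.
Local Open Scope ring_scope.
Local Open Scope ereal_scope.

(** * Borel maps with a non-Borel range *)

Definition coord_sets : set (set (nat -> bool)) :=
  range (fun n => [set z : nat -> bool | z n]).

(** Cantor space with the product sigma-algebra, which is its Borel sigma-algebra. *)
Notation bits := (g_sigma_algebraType coord_sets).

Lemma measurable_coord (n : nat) : measurable [set z : bits | z n].
Proof. by apply: sub_sigma_algebra; exists n. Qed.

Lemma measurable_bits d (X : measurableType d) (f : X -> bits) :
  (forall n, measurable [set x | f x n]) -> measurable_fun setT f.
Proof.
move=> mf; refine (measurability (rT := bits) coord_sets _ _) => //.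
by move=> _ [_ [n _ <-] <-]; rewrite setTI; exact: mf.
Qed.

Lemma countable_bigcapT_measurable d (X : measurableType d) (I : countType)
    (F : I -> set X) : (forall i, measurable (F i)) -> measurable (\bigcap_i F i).
Proof.
move=> mF; rewrite -[X in measurable X]setCK setC_bigcap; apply: measurableC.
by apply: countable_bigcupT_measurable => // i; exact: measurableC.
Qed.

(* A code [c] describes a closed subset of [2^N * N^N]: the triple
   [((n, b), q)] in [c] forbids [z n = b] together with [w i = v] for all
   [(i, v)] in [q].  [suslin c] is the projection of that closed set. *)
Definition suslin (c : set ((nat * bool) * seq (nat * nat))) : set (nat -> bool) :=
  [set z | exists w : nat -> nat, forall t, c t -> z t.1.1 = t.1.2 ->
     ~~ all (fun iv => w iv.1 == iv.2) t.2].

(** The witness first names the index: [w 0] is [k] and the tail of [w] is a witness for [A k].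
    Prepending [(0, k)] to a constraint of [c k] and shifting its positions makes it bind only when
    [w 0 = k]. *)
Lemma suslin_bigcup (A : (set (nat -> bool))^nat) :
  (forall k, range suslin (A k)) -> range suslin (\bigcup_k A k).
Proof.
move=> sA; have /choice[c cA] : forall k, exists c, suslin c = A k.
  by move=> k; have [c _ <-] := sA k; exists c.
exists [set t | exists k s, c k s /\
  t = (s.1, (0, k)%N :: [seq (iv.1.+1, iv.2) | iv <- s.2])] => //.
apply/seteqP; split=> [z [w zw]|z [k _]].
  exists (w 0%N) => //; rewrite -cA; exists (w \o S) => t ct zt.
  have /(_ _)/= := zw (t.1, (0, w 0)%N :: [seq (iv.1.+1, iv.2) | iv <- t.2]).
  rewrite eqxx /= all_map; apply => //.
  by exists (w 0%N), t.
rewrite -cA => -[w zw].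
exists (fun i => if i is j.+1 then w j else k) => _ [l [s [cs ->]]] /= zs.
have [kl/=|//] := eqVneq k l; rewrite -kl in cs.
by rewrite all_map; exact: zw.
Qed.

(** One sequence stores a witness for every [A k], the [k]-th at the positions [pickle (k, i)]; the
    constraints of [c k] are moved to these positions. *)
Lemma suslin_bigcap (A : (set (nat -> bool))^nat) :
  (forall k, range suslin (A k)) -> range suslin (\bigcap_k A k).
Proof.
move=> sA; have /choice[c cA] : forall k, exists c, suslin c = A k.
  by move=> k; have [c _ <-] := sA k; exists c.
pose p (k i : nat) := pickle (k, i).
exists [set t | exists k s, c k s /\
  t = (s.1, [seq (p k iv.1, iv.2) | iv <- s.2])] => //.
apply/seteqP; split=> [z [w zw] k _|z Az].
  rewrite -cA; exists (w \o p k) => t ct zt.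
  have /(_ _)/= := zw (t.1, [seq (p k iv.1, iv.2) | iv <- t.2]).
  by rewrite all_map; apply => //; exists k, t.
have /choice[w zw] : forall k, exists w : nat -> nat,
    forall t, c k t -> z t.1.1 = t.1.2 ->
      ~~ all (fun iv => w iv.1 == iv.2) t.2.
  by move=> k; have := Az k Logic.I; rewrite -cA.
exists (fun i => if unpickle i is Some (k, j) then w k j else 0%N).
move=> _ [k [s [cs ->]]] /= zs; rewrite all_map.
have := zw k s cs zs; apply: contra => /allP h; apply/allP => iv /h /=.
by rewrite /p pickleK.
Qed.

Lemma suslin_coord n b : range suslin [set z | z n = b].
Proof.
(* With an empty list the condition on [w] holds vacuously, so the triple forbids the wrong value of
   [z n] outright. *)
exists [set ((n, ~~ b), [::])] => //; apply/seteqP; split=> z /=.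
  move=> [w /(_ _ erefl)/=]; by case: (z n); case: b => // /(_ erefl).
by move=> zn; exists (fun=> 0%N) => t -> /=; rewrite zn; case: b {zn}.
Qed.

(** Suslin sets are not stable under complement, so the induction runs over the sets that are Suslin
    together with their complement; these form a sigma-algebra. *)
Lemma measurable_suslin (A : set bits) : measurable A -> range suslin A.
Proof.
suff h : coord_sets.-sigma.-measurable `<=`
    [set B | range suslin B /\ range suslin (~` B)] by move=> /h[].
apply: smallest_sub; last first.
  move=> _ [n _ <-]; split; first exact: suslin_coord n true.
  rewrite (_ : ~` _ = [set z | z n = false]); first exact: suslin_coord.
  by apply/seteqP; split=> z /=; case: (z n).
split=> [|B [sB sCB]|F sF].
- split; last rewrite setC0.
    (* The indices 0 and 1 already impose opposite values on [z 0]; the union of the same sets is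
       everything. *)
    rewrite (_ : set0 = \bigcap_k [set z : nat -> bool | z 0%N = odd k]).
      by apply: suslin_bigcap => k; exact: suslin_coord.
    by apply/seteqP; split=> // z h; have := h 0%N Logic.I; have /= -> := h 1%N Logic.I.
  rewrite (_ : setT = \bigcup_k [set z : nat -> bool | z 0%N = odd k]).
    by apply: suslin_bigcup => k; exact: suslin_coord.
  apply/seteqP; split=> // z _.
  by exists (z 0%N : nat) => //=; case: (z 0%N).
- by rewrite setTD /= setCK.
- split; first by apply: suslin_bigcup => k; have [] := sF k.
  by rewrite setC_bigcup; apply: suslin_bigcap => k; have [] := sF k.
Qed.

(** The diagonal of the universal Suslin set: [z] is read through [pickle] as a code and tested
    against the set that it codes. *)
Definition suslin_diag : set (nat -> bool) :=
  [set z : nat -> bool | suslin [set t | z (pickle t)] z].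

(** Cantor's diagonal argument: otherwise the complement would be [suslin c] for some [c], and the
    point [z] that codes [c] would lie in the diagonal exactly when it does not. *)
Lemma suslin_diag_nonmeasurable : ~ measurable (suslin_diag : set bits).
Proof.
move=> /measurableC/measurable_suslin[c _ cE].
pose z n := `[< exists2 t, c t & pickle t = n >].
have zE : [set t | z (pickle t)] = c.
  apply/seteqP; split=> t /=.
    by move=> /asboolP[s cs /(pcan_inj pickleK) <-].
  by move=> ct; apply/asboolP; exists t.
have : suslin c z <-> suslin_diag z by rewrite /suslin_diag /= zE.
by rewrite cE /setC /=; tauto.
Qed.

(** A point [s] stores a candidate [p s] and a relation [r s] that stands for the graph of a
    witness; [g] returns the candidate when the relation certifies membership in [suslin_diag].
    Projection thus becomes the range of a Borel map. *)
Lemma nonmeasurable_range_bits : exists2 g : bits -> bits,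
  measurable_fun setT g & ~ measurable (range g).
Proof.
pose p (s : bits) : nat -> bool := fun n => s (pickle (inl n : nat + nat * nat)).
pose r (s : bits) iv := s (pickle (inr iv : nat + nat * nat)).
(* The relation need only be total: no forbidden list lies inside [r s], so every choice function of
   [r s] is a witness. This makes [good] a countable combination of coordinate conditions. *)
pose good s := (forall i, exists v, r s (i, v)) /\
  forall t : (nat * bool) * seq (nat * nat), p s (pickle t) ->
    p s t.1.1 = t.1.2 -> ~~ all (r s) t.2.
pose g s : bits := fun n => `[< good s >] && p s n.
have mp n : measurable [set s | p s n] by exact: measurable_coord.
have mr iv : measurable [set s | r s iv] by exact: measurable_coord.
exists g.
  apply: measurable_bits => n.
  rewrite (_ : [set _ | _] = good `&` [set s | p s n]); last first.
    apply/seteqP; split=> s; rewrite /g /=; first by move=> /andP[/asboolP].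
    by move=> [gs ->]; rewrite andbT; exact/asboolP.
  apply: measurableI => //.
  rewrite (_ : good = (\bigcap_i \bigcup_v [set s | r s (i, v)]) `&`
      \bigcap_(t in [set: (nat * bool) * seq (nat * nat)])
        (~` [set s | p s (pickle t)] `|` ~` [set s | p s t.1.1 = t.1.2] `|`
         ~` [set s | all (r s) t.2])); last first.
    apply/seteqP; split=> s /=.
      move=> [g1 g2]; split=> [i _|t _].
        by have [v rv] := g1 i; exists v.
      have [pt|] := boolP (p s (pickle t)); last by left; left; apply/negP.
      have [pt'|pt'] := eqVneq (p s t.1.1) t.1.2.
        by right; apply/negP; exact: g2.
      by left; right; apply/eqP.
    move=> [g1 g2]; split=> [i|t pt pt'].
      by have [v _ rv] := g1 i Logic.I; exists v.
    by have [[//|//]|] := g2 t Logic.I; move/negP.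
  apply: measurableI.
    apply: bigcap_measurable => // i _; apply: bigcup_measurable => v _.
    exact: mr.
  apply: countable_bigcapT_measurable => -[[n' b] q] /=.
  apply: measurableU; [apply: measurableU|]; apply: measurableC => //.
    case: b; first exact: mp.
    rewrite (_ : [set _ | _] = ~` [set s | p s n']).
      exact: measurableC.
    by apply/seteqP; split=> s /= => [->|/negP/negbTE].
  elim: q => [|iv q IH].
    by rewrite (_ : [set _ | _] = setT) //; apply/seteqP; split.
  rewrite (_ : [set _ | _] = [set s | r s iv] `&` [set s | all (r s) q]).
    exact: measurableI.
  by apply/seteqP; split=> s /=; [move=> /andP[]|move=> [-> ->]].
suff -> : range g = suslin_diag by exact: suslin_diag_nonmeasurable.
apply/seteqP; split=> z.
  move=> [s _ <-]; rewrite /suslin_diag /= /g.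
  (* A point that is not good goes to the zero sequence, which codes no constraint and so belongs to
     the diagonal. *)
  case: asboolP => [[+ g2]|_] /=; last by exists (fun=> 0%N).
  move=> /choice[w rw]; exists w => t ct pt.
  have := g2 t ct pt; apply: contra => /allP h; apply/allP => -[i v] /h /= /eqP <-.
  exact: rw.
move=> [w zw].
exists (fun n => match unpickle n : option (nat + nat * nat) with
  | Some (inl m) => z m | Some (inr iv) => w iv.1 == iv.2 | None => false end) => //.
set s := (X in g X).
have pE : p s = z by apply/funext => n; rewrite /p /s pickleK.
have rE iv : r s iv = (w iv.1 == iv.2) by rewrite /r /s pickleK.
apply/funext => n; rewrite /g pE; suff -> : `[< good s >] by [].
apply/asboolP; split=> [i|t]; first by exists (w i); rewrite rE eqxx.
rewrite pE => ct zt; have := zw t ct zt.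
by rewrite (@eq_all _ (r s) (fun iv => w iv.1 == iv.2) rE).
Qed.

(** * Ternary coding of bit sequences by real numbers *)

Section ternary_code.
Local Open Scope ring_scope.
Context {R : realType}.
Implicit Types z : bits.

Let term z : R^nat := fun n => (z n)%:R * 3^-1 ^+ n.

(** Digits 0 and 1 in base 3 leave gaps, so that distinct sequences have distinct sums; in base 2
    this would fail. *)
Definition code z : R := limn (series (term z)).

Let norm_third : `|3^-1 : R| < 1.
Proof. by rewrite ger0_norm // invf_lt1 // ltr1n. Qed.

Let term_ge0 z n : 0 <= term z n.
Proof. by rewrite mulr_ge0 // exprn_ge0. Qed.

Let term_le z n : term z n <= geometric 1 3^-1 n.
Proof.
by rewrite /= ler_wpM2r ?exprn_ge0 // (@ler_nat R _ 1); case: (z n).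
Qed.

Let cvg_term z : cvgn (series (term z)).
Proof.
apply: (series_le_cvg (term_ge0 z) _ (term_le z)).
  by move=> n; apply: geometric_ge0; rewrite // invr_ge0.
exact: is_cvg_geometric_series.
Qed.

Lemma code_ge0 z : 0 <= code z.
Proof.
apply: limr_ge; first exact: cvg_term.
by apply: nearW => n; apply: sumr_ge0 => i _; exact: term_ge0.
Qed.

Lemma code_le z : code z <= 3 / 2.
Proof.
have -> : 3 / 2 = limn (series (geometric (1 : R) 3^-1)).
  rewrite (cvg_lim _ (@cvg_geometric_series R 1 _ norm_third)) //; by field.
apply: lim_series_le; [exact: cvg_term| |exact: term_le].
exact: is_cvg_geometric_series.
Qed.

Lemma codeS z : code z = (z 0%N)%:R + 3^-1 * code (z \o S).
Proof.
apply/cvg_lim => //; rewrite -cvg_shiftS.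
rewrite (_ : [sequence _]_n =
    fun n => (z 0%N)%:R + 3^-1 * series (term (z \o S)) n); last first.
  apply/funext => n; rewrite /series /= big_nat_recl // {1}/term expr0 mulr1.
  congr (_ + _); rewrite mulr_sumr; apply: eq_bigr => i _.
  by rewrite /term exprS mulrCA.
by apply: cvgD; [exact: cvg_cst|apply: cvgMl_tmp; exact: cvg_term].
Qed.

(** The digits after the first contribute at most [3^-1 * (3 / 2)], that is 1/2, so comparison with
    1 reads off the first digit. *)
Lemma code_ge1 z : (1 <= code z) = z 0%N.
Proof.
rewrite codeS; have := code_ge0 (z \o S); have := code_le (z \o S).
by case: (z 0%N) => /=; lra.
Qed.

Definition shift_code (x : R) : R := 3 * (x - (1 <= x)%R%:R).

Lemma shift_codeE z : shift_code (code z) = code (z \o S).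
Proof. by rewrite /shift_code code_ge1 {1}codeS; field. Qed.

(** Defined on all of [R], where it is Borel; its values outside the range of [code] carry no
    meaning. *)
Definition decode (x : R) : bits := fun n => 1 <= iter n shift_code x.

Lemma codeK : cancel code decode.
Proof.
move=> z; apply/funext => n; rewrite /decode.
suff -> : iter n shift_code (code z) = code (z \o addn n).
  by rewrite code_ge1 /= addn0.
elim: n => [|n IH]; first by congr code; apply/funext.
by rewrite iterS IH shift_codeE; congr code; apply/funext => m /=; rewrite addSnnS.
Qed.

Lemma measurable_code : measurable_fun setT code.
Proof.
apply: (@measurable_fun_cvg _ _ _ setT (fun n z => series (term z) n)); last first.
  by move=> z _; exact: cvg_term.
move=> m; apply: measurable_sum => n; apply: measurable_funM => //.
rewrite (_ : (fun z => _) = \1_[set z : bits | z n]).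
  by apply: measurable_indic; exact: measurable_coord.
by apply/funext => z; rewrite indicE mem_setE.
Qed.

Lemma measurable_decode : measurable_fun setT decode.
Proof.
apply: measurable_bits => n.
have mge1 : measurable [set x : R | 1 <= x].
  rewrite (_ : [set x | _] = `[1, +oo[%classic); first exact: measurable_itv.
  by apply/seteqP; split=> x /=; rewrite in_itv /= andbT.
have mshift : measurable_fun setT shift_code.
  apply: measurable_funM => //; apply: measurable_funB => //.
  rewrite (_ : (fun x => _) = \1_[set x : R | 1 <= x]).
    exact: measurable_indic.
  by apply/funext => z; rewrite indicE mem_setE.
have miter : measurable_fun setT (iter n shift_code).
  elim: n => [|n IH]; first exact: measurable_id.
  exact: (measurableT_comp mshift IH).
by have := miter measurableT _ mge1; rewrite setTI.
Qed.

End ternary_code.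

(** * Inner regularity and compact classes *)

Lemma negligible_countable_bigcup d (X : measurableType d) (R : realType)
    (mu : {measure set X -> \bar R}) (I : countType) (F : I -> set X) :
  (forall i, mu.-negligible (F i)) -> mu.-negligible (\bigcup_i F i).
Proof.
move=> F0; apply: (@negligibleS _ _ _ _
    (\bigcup_n (if unpickle n is Some i then F i else set0))).
  by move=> x [i _ Fx]; exists (pickle i); rewrite ?pickleK.
by apply: negligible_bigcup => n; case: unpickle => // *; exact: negligible_set0.
Qed.

Lemma measure_bigcap_lt d (X : measurableType d) (R : realType)
    (mu : {measure set X -> \bar R}) (F : (set X)^nat) (c : \bar R) :
  mu (F 0%N) < +oo -> (forall n, measurable (F n)) -> nonincreasing_seq F ->
  mu (\bigcap_n F n) < c -> exists n, mu (F n) < c.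
Proof.
move=> F0 mF niF Fc; apply: contrapT => /forallNP h.
have cF : mu \o F @ \oo --> mu (\bigcap_n F n).
  by apply: nonincreasing_cvg_mu => //; exact: bigcapT_measurable.
move: Fc; rewrite ltNge => /negP; apply.
rewrite -(cvg_lim _ cF) //; apply: lime_ge; first by apply/cvg_ex; eexists; exact: cF.
by apply: nearW => n; rewrite leNgt; apply/negP; exact: h.
Qed.

Lemma measure_bigcup_gt d (X : measurableType d) (R : realType)
    (mu : {measure set X -> \bar R}) (F : (set X)^nat) (c : \bar R) :
  (forall n, measurable (F n)) -> nondecreasing_seq F ->
  c < mu (\bigcup_n F n) -> exists n, c < mu (F n).
Proof.
move=> mF ndF Fc; apply: contrapT => /forallNP h.
have cF : mu \o F @ \oo --> mu (\bigcup_n F n).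
  by apply: nondecreasing_cvg_mu => //; exact: bigcupT_measurable.
move: Fc; rewrite ltNge => /negP; apply.
rewrite -(cvg_lim _ cF) //; apply: lime_le; first by apply/cvg_ex; eexists; exact: cF.
by apply: nearW => n; rewrite leNgt; apply/negP; exact: h.
Qed.

Section inner_regularity.
Context d (X : measurableType d) (R : realType).
Variables (mu : {finite_measure set X -> \bar R}) (K : set (set X)).
Hypothesis mK : K `<=` measurable.
Hypothesis K0 : K set0.
Hypothesis KT : K setT.
Hypothesis KU : setU_closed K.
Hypothesis KI : forall F : (set X)^nat, (forall n, K (F n)) -> K (\bigcap_n F n).

Definition inner_regular (A : set X) := forall e : R, (0 < e)%R ->
  exists C, [/\ K C, C `<=` A & mu (A `\` C) < e%:E].

Lemma inner_regular_mem C : K C -> inner_regular C.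
Proof. by move=> KC e e0; exists C; split=> //; rewrite setDv measure0 lte_fin. Qed.

Lemma inner_regular_seq (F : (set X)^nat) (e : R) : (0 < e)%R ->
  (forall n, measurable (F n)) -> (forall n, inner_regular (F n)) ->
  exists C : (set X)^nat, [/\ forall n, K (C n), forall n, C n `<=` F n &
    mu (\bigcup_n (F n `\` C n)) < e%:E].
Proof.
move=> e0 mF rF.
(* The errors sum to at most [e / 2], which leaves room for the strict inequality. *)
have e2 n : (0 < e / 2 / (2 ^ n.+1)%:R)%R.
  by rewrite !divr_gt0 // ltr0n expn_gt0.
have /choice[C CP] := fun n => rF n _ (e2 n).
exists C; split=> [n|n|]; [by case: (CP n)|by case: (CP n)|].
have mFC n : measurable (F n `\` C n).
  by apply: measurableD => //; apply: mK; case: (CP n).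
apply: (@le_lt_trans _ _ (\sum_(0 <= n <oo) mu (F n `\` C n))).
  by apply: measure_sigma_subadditive => //; exact: bigcupT_measurable.
apply: (@le_lt_trans _ _ (\sum_(0 <= n <oo) (e / 2 / (2 ^ n.+1)%:R)%:E)).
  by apply: lee_nneseries => // n _; apply/ltW; case: (CP n).
apply: (le_lt_trans (epsilon_trick0 xpredT _)); first by rewrite divr_ge0 // ltW.
by rewrite lte_fin ltr_pdivrMr // ltr_pMr // ltr1n.
Qed.

Lemma inner_regular_bigcap (F : (set X)^nat) :
  (forall n, measurable (F n)) -> (forall n, inner_regular (F n)) ->
  inner_regular (\bigcap_n F n).
Proof.
move=> mF rF e e0; have [C [KC CF Ce]] := inner_regular_seq e0 mF rF.
exists (\bigcap_n C n); split; first exact: KI.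
  by move=> x Cx n _; apply: CF; exact: Cx.
apply: le_lt_trans Ce; apply: le_measure; rewrite ?inE.
- apply: measurableD; first exact: bigcapT_measurable.
  by apply: bigcapT_measurable => n; exact: mK.
- by apply: bigcupT_measurable => n; apply: measurableD => //; exact: mK.
- move=> x [Fx /existsNP[n /not_implyP[_ Cx]]].
  by exists n => //; split=> //; exact: Fx.
Qed.

Lemma inner_regular_bigcup (F : (set X)^nat) :
  (forall n, measurable (F n)) -> (forall n, inner_regular (F n)) ->
  inner_regular (\bigcup_n F n).
Proof.
move=> mF rF e e0; have [C [KC CF Ce]] := inner_regular_seq e0 mF rF.
have mFU : measurable (\bigcup_n F n) by exact: bigcupT_measurable.
have KCn n : K (\big[setU/set0]_(i < n) C i).
  elim: n => [|n IH]; first by rewrite big_ord0.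
  by rewrite big_ord_recr; exact: KU.
(* The union of all the [C n] need not be in [K]; continuity from above replaces it by a finite
   union. *)
have [||||n nP] := @measure_bigcap_lt _ _ _ mu
    (fun n => \bigcup_n F n `\` \big[setU/set0]_(i < n) C i) e%:E.
- by rewrite ltey_eq fin_num_measure // big_ord0 setD0.
- by move=> n; apply: measurableD => //; exact: mK.
- by move=> m n mn; apply/subsetPset; apply: setDS; exact: subset_bigsetU.
- apply: le_lt_trans Ce; apply: le_measure; rewrite ?inE.
  + by apply: bigcapT_measurable => n; apply: measurableD => //; exact: mK.
  + by apply: bigcupT_measurable => n; apply: measurableD => //; exact: mK.
  + move=> x h; have [[n _ Fx] _] := h 0%N Logic.I; exists n => //; split=> // Cx.
    have [_] := h n.+1 Logic.I; apply; rewrite -bigcup_mkord; by exists n => /=.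
- exists (\big[setU/set0]_(i < n) C i); split=> //.
  by rewrite -bigcup_mkord => x [i _ Cx]; exists i => //; exact: CF.
Qed.

(** Inner regularity of a set says nothing about its complement, so both are carried through the
    induction; complements of unions are handled by the closure under countable intersections. *)
Lemma g_sigma_algebra_inner_regular (G : set (set X)) : G `<=` measurable ->
  (forall A, G A -> inner_regular A /\ inner_regular (~` A)) ->
  <<s G >> `<=` inner_regular.
Proof.
move=> mG rG.
suff h : <<s G >> `<=`
    [set A | [/\ measurable A, inner_regular A & inner_regular (~` A)]].
  by move=> A /h[].
apply: smallest_sub; last by move=> A GA; have [] := rG _ GA; split=> //; exact: mG.
split=> [|A [mA rA rCA]|F rF].
- split=> //; first exact: inner_regular_mem.
  by rewrite setC0; exact: inner_regular_mem.
- by rewrite setTD; split; [exact: measurableC| |rewrite setCK].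
- have mF n : measurable (F n) by have [] := rF n.
  split; first exact: bigcupT_measurable.
    by apply: inner_regular_bigcup => // n; have [] := rF n.
  rewrite setC_bigcup; apply: inner_regular_bigcap => n; first exact: measurableC.
  by have [] := rF n.
Qed.

End inner_regularity.

Lemma countably_generated_seq d (X : measurableType d) :
  countably_generated X ->
  exists A : (set X)^nat, @measurable d X = <<s range A >>.
Proof.
move=> [G [/countable_injP[f finj] GE]].
(* Indices outside the range of the injection get [set0], which does not enlarge the generated
   sigma-algebra. *)
pose A n : set X := xget set0 [set B | G B /\ f B = n].
have GA : G `<=` range A.
  move=> B GB; exists (f B) => //; rewrite /A.
  case: xgetP => [C _ [GC fC]|/(_ B)[]//].
  by apply: finj => //; rewrite inE.
exists A; apply/seteqP; split; first by rewrite GE; exact: sub_sigma_algebra2.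
apply: smallest_sub; first exact: sigma_algebra_measurable.
move=> _ [n _ <-]; rewrite /A; case: xgetP => [C _ [GC _]|_]; last exact: measurable0.
by rewrite GE; exact: sub_sigma_algebra.
Qed.

Lemma closed_inner_regular (R : realType)
    (mu : {finite_measure set R -> \bar R}) (A : set R) :
  measurable A -> inner_regular mu closed A.
Proof.
rewrite [measurable](RGenOInfty.measurableE R) => sA.
apply: (@g_sigma_algebra_inner_regular _ _ _ mu closed) sA.
- exact: closed_measurable.
- exact: closed0.
- exact: closedT.
- exact: closedU.
- by move=> F cF; apply: closed_bigI.
- by move=> _ [x ->]; exact: measurable_itv.
(* An open ray is a countable union of closed rays, and its complement is closed. *)
- move=> _ [x ->]; split; last first.
    by rewrite setCitvr; apply: inner_regular_mem => //; exact: interval_closed.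
  rewrite itvoyEbigcup; apply: inner_regular_bigcup.
  + exact: closed_measurable.
  + exact: closed0.
  + exact: closedU.
  + by move=> n; exact: measurable_itv.
  + by move=> n; apply: inner_regular_mem; exact: interval_closed.
Qed.

Lemma closed_bounded_nested (R : realType) (C : (set R)^nat) (a b : R) :
  (forall n, closed (C n)) -> C 0%N `<=` `[a, b]%classic ->
  nonincreasing_seq C -> (forall n, C n !=set0) -> \bigcap_n C n !=set0.
Proof.
move=> cC Cab niC C0.
have : compact (C 0%N).
  by apply: subclosed_compact Cab => //; exact: segment_compact.
rewrite compact_In0 => /(_ _ setT C); apply.
  exists C => // i _; rewrite setIidr //; exact/subsetPset/niC.
move=> D _; have [x Cx] := C0 (\max_(i <- finmap.enum_fset D) i)%N.
exists x => i /= iD; move: Cx; apply/subsetPset/niC.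
by apply: leq_bigmax_seq.
Qed.

(** The generators combine into one map [phi] to a bounded part of [R] that pulls the Borel sets
    back onto the whole sigma-algebra. Perfectness puts almost all of the image measure on a Borel
    set inside the range of [phi], so compactness of closed bounded sets can be lifted to [X]. *)
Lemma perfect_compact_class d (X : measurableType d) (R : realType)
    (P : probability X R) :
  countably_generated X ->
  (forall f : X -> R, measurable_fun setT f -> exists E : set R,
    [/\ measurable E, E `<=` range f & P (f @^-1` E) = P setT]) ->
  exists K : set (set X), [/\ K `<=` measurable,
    forall U, measurable U -> 0 < P U -> exists C, [/\ K C, C `<=` U & 0 < P C] &
    forall C : (set X)^nat, (forall n, K (C n)) -> nonincreasing_seq C ->
      (forall n, C n !=set0) -> \bigcap_n C n !=set0].
Proof.
move=> /countably_generated_seq[A AE] perfP.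
have mA n : measurable (A n) by rewrite AE; apply: sub_sigma_algebra; exists n.
pose b x : bits := fun n => x \in A n.
have mb : measurable_fun setT b.
  apply: measurable_bits => n; rewrite (_ : [set _ | _] = A n) //.
  by apply/seteqP; split=> x /=; rewrite inE.
pose phi x : R := code (b x).
have mphi : measurable_fun setT phi by exact: measurableT_comp measurable_code mb.
(* Enough to check the generators: [A n] is the preimage of the set of reals whose decoded [n]-th
   bit is true. *)
have phiP U : measurable U -> exists2 B, measurable B & phi @^-1` B = U.
  rewrite AE => sU.
  suff [B mB <-] : preimage_set_system setT phi measurable U.
    by exists B; rewrite ?setTI.
  apply: smallest_sub sU.
    exact: sigma_algebra_preimage (sigma_algebra_measurable _).
  move=> _ [n _ <-]; exists (decode @^-1` [set z : bits | z n]).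
    have := @measurable_decode R measurableT _ (measurable_coord n).
    by rewrite setTI.
  rewrite setTI; apply/seteqP; split=> x; rewrite /= /phi codeK /b inE //.
have [E [mE Ephi PE]] := perfP _ mphi.
pose mu : probability R R := distribution P (mfun_Sub (mem_set mphi) : {mfun X >-> R}).
have muE B : mu B = P (phi @^-1` B) by [].
(* The condition that [F] lies in [E], hence in the range of [phi], is what lets a limit point in
   [R] be lifted to a point of [X]. *)
exists [set C | exists2 F, closed F /\ F `<=` E & C = phi @^-1` F]; split.
- move=> _ [F [cF _] ->].
  by have := mphi measurableT _ (closed_measurable cF); rewrite setTI.
- move=> U /phiP[B mB <-] PB.
  have mBE : measurable (B `&` E) by exact: measurableI.
  have PBE : 0 < mu (B `&` E).
    have mBD : measurable (B `\` E) by exact: measurableD.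
    have muBDI : mu B = mu (B `\` E) + mu (B `&` E) by exact: measureDI.
    suff BE0 : mu (B `\` E) = 0 by move: PB; rewrite -muE muBDI BE0 add0e.
    have muE1 : mu E = 1 by rewrite muE PE probability_setT.
    have muCE : mu (~` E) = 0.
      have -> : mu (~` E) = 1 - mu E by exact: probability_setC.
      by rewrite muE1 subee.
    by apply: subset_measure0 muCE => //; exact: measurableC.
  have e0 : (0 < fine (mu (B `&` E)))%R.
    by rewrite fine_gt0 // PBE ltey_eq fin_num_measure.
  have [F [cF FB Fe]] := @closed_inner_regular R mu _ mBE _ e0.
  exists (phi @^-1` F); split.
  + by exists F => //; split=> // x /FB[].
  + by move=> x /FB[].
  + rewrite -muE lt_neqAle measure_ge0 andbT; apply/eqP => F0.
    have muBEF : mu ((B `&` E) `\` F) = mu (B `&` E) - mu F.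
      rewrite measureD ?(setIidr FB) //; first exact: closed_measurable.
      by rewrite ltey_eq fin_num_measure.
    have : mu ((B `&` E) `\` F) < (fine (mu (B `&` E)))%:E by exact: Fe.
    by rewrite muBEF -F0 sube0 fineK ?fin_num_measure // ltxx.
- move=> C KC niC C0.
  have /choice[F FP] : forall n, exists F, [/\ closed F, F `<=` E & C n = phi @^-1` F].
    by move=> n; have [F [cF FE] CF] := KC n; exists F.
  (* As [F n] lies in the range of [phi], it is recovered as an image, and inherits monotonicity and
     non-emptiness from [C n]. *)
  have FC n : F n = phi @` C n.
    have [_ FE ->] := FP n; apply/seteqP; split=> [r Fr|_ [x Fx <-] //].
    by have [x _ xr] := Ephi _ (FE _ Fr); exists x; rewrite //= xr.
  have [r rF] : \bigcap_n F n !=set0.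
    apply: (@closed_bounded_nested R F 0 (3 / 2)).
    + by move=> n; case: (FP n).
    + move=> r; rewrite FC => -[x _ <-].
      by rewrite /= in_itv /= code_ge0 code_le.
    + move=> m n mn; apply/subsetPset; rewrite !FC; apply: image_subset.
      exact/subsetPset/niC.
    + by move=> n; rewrite FC; have [x Cx] := C0 n; exists (phi x), x.
  have [x _ xr] : range phi r.
    by apply: Ephi; case: (FP 0%N) => _ FE _; apply: FE; exact: rF.
  by exists x => n _; case: (FP n) => _ _ ->; rewrite /= xr; exact: rF.
Qed.

(** * The algebra generated by a sequence of sets *)

Section generated_algebra.
Context (X : Type) (B : (set X)^nat).

(* Finite trees index the algebra generated by the [B n]: a node is the
   complement of the union of its children. *)
Fixpoint alg (t : GenTree.tree nat) : set X :=
  match t with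
  | GenTree.Leaf n => B n
  | GenTree.Node _ ts => ~` foldr (fun s => setU (alg s)) set0 ts
  end.

Lemma algC s : exists t, alg t = ~` alg s.
Proof. by exists (GenTree.Node 0 [:: s]); rewrite /= setU0. Qed.

Lemma algU s1 s2 : exists t, alg t = alg s1 `|` alg s2.
Proof.
have [t tE] := algC (GenTree.Node 0 [:: s1; s2]).
by exists t; rewrite tE /= setU0 setCK.
Qed.

Lemma algI s1 s2 : exists t, alg t = alg s1 `&` alg s2.
Proof.
have [t1 t1E] := algC s1; have [t2 t2E] := algC s2; have [t tE] := algU t1 t2.
by have [u uE] := algC t; exists u; rewrite uE tE t1E t2E setCU !setCK.
Qed.

Lemma algT : exists t, alg t = setT.
Proof. by exists (GenTree.Node 0 [::]); rewrite /= setC0. Qed.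

Lemma alg_bigsetU (t : nat -> GenTree.tree nat) n :
  exists u, alg u = \big[setU/set0]_(i < n) alg (t i).
Proof.
elim: n => [|n [u uE]].
  by have [s sE] := algT; have [u uE] := algC s; exists u; rewrite big_ord0 uE sE setCT.
by have [v vE] := algU u (t n); exists v; rewrite big_ord_recr /= vE uE.
Qed.

End generated_algebra.

Section generated_algebra_measure.
Context d (X : measurableType d) (B : (set X)^nat).
Hypothesis BE : @measurable d X = <<s range B >>.

Lemma measurable_alg t : measurable (alg B t).
Proof.
elim: t => [n|_ ts IH] /=; first by rewrite BE; apply: sub_sigma_algebra; exists n.
apply: measurableC; elim: ts IH => [|s ts IHts] /=; first by move=> _; exact: measurable0.
by move=> [ms mts]; apply: measurableU => //; exact: IHts.
Qed.

(** Inner regularity of the complement of [A] with respect to countable intersections of algebra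
    members; taking complements turns these into countable unions that cover [A]. *)
Lemma alg_outer_approx (R : realType) (mu : {finite_measure set X -> \bar R})
    (A : set X) (e : R) : measurable A -> (0 < e)%R ->
  exists t : nat -> GenTree.tree nat, A `<=` \bigcup_n alg B (t n) /\
    mu (\bigcup_n alg B (t n) `\` A) < e%:E.
Proof.
move=> mA e0; pose K := range (fun t : nat -> GenTree.tree nat => \bigcap_n alg B (t n)).
have Kalg s : K (alg B s) by exists (fun=> s) => //; exact: bigcap_const.
have mCA : <<s range B >> (~` A) by rewrite -BE; exact: measurableC.
have := @g_sigma_algebra_inner_regular _ _ _ mu K _ _ _ _ _ (range B) _ _ _ mCA e e0.
move=> /(_ _)[].
- by move=> _ [t _ <-]; apply: bigcapT_measurable => n; exact: measurable_alg.
- by have [s sE] := algT B; have [u uE] := algC B s; rewrite -setCT -sE -uE.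
- by have [s <-] := algT B.
- move=> _ _ [t1 _ <-] [t2 _ <-].
  (* By distributivity the union of two intersections is an intersection over pairs of indices;
     numbers that code no pair contribute [setT]. *)
  have /choice[t tE] : forall n, exists u,
      alg B u = if unpickle n is Some (i, j) then alg B (t1 i) `|` alg B (t2 j) else setT.
    by move=> n; case: unpickle => [[i j]|]; [exact: algU|exact: algT].
  exists t => //; apply/seteqP; split=> x.
    move=> h; apply: contrapT => /not_orP[].
    move=> /existsNP[i /not_implyP[_ xi]] /existsNP[j /not_implyP[_ xj]].
    by have := h (pickle (i, j)) Logic.I; rewrite tE pickleK => -[].
  move=> h n _; rewrite tE; case: unpickle => [[i j]|] //.
  by case: h => h; [left|right]; exact: h.
- move=> F KF.
  have /choice[t tE] : forall n, exists t : nat -> GenTree.tree nat, \bigcap_i alg B (t i) = F n.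
    by move=> n; have [t _ <-] := KF n; exists t.
  have /choice[u uE] : forall n, exists u,
      alg B u = if unpickle n is Some (i, j) then alg B (t i j) else setT.
    by move=> n; case: unpickle => [[i j]|]; [exists (t i j)|exact: algT].
  exists u => //; apply/seteqP; split=> x.
    move=> h n _; rewrite -tE => j _.
    by have := h (pickle (n, j)) Logic.I; rewrite uE pickleK.
  move=> h n _; rewrite uE; case: unpickle => [[i j]|] //.
  by have := h i Logic.I; rewrite -tE; exact.
- by move=> _ [n _ <-]; exact: measurable_alg (GenTree.Leaf n).
- move=> _ [n _ <-]; split; apply: inner_regular_mem; first exact: (Kalg (GenTree.Leaf n)).
  by have [t <-] := algC B (GenTree.Leaf n).
- move=> C [[t _ <-] CA mCAC].
  have /choice[u uE] := fun n => algC B (t n).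
  have uE' : \bigcup_n alg B (u n) = ~` \bigcap_n alg B (t n).
    by rewrite setC_bigcap; apply: eq_bigcupr => n _; exact: uE.
  exists u; split.
    by rewrite uE' -[X in X `<=` _]setCK; exact: subsetC.
  by rewrite uE' setDE setIC -setDE.
Qed.

End generated_algebra_measure.

(** * The Cantor scheme of a singular joint measure *)

Section splitting.
Context dH dD (H : measurableType dH) (D : measurableType dD) (R : realType).
Variables (P : probability H R) (Q : probability D R) (S : R.-pker H ~> D).
Hypothesis QE : forall V, measurable V -> Q V = \int[P]_x S x V.
Variable (B : (set D)^nat).
Hypothesis BE : @measurable dD D = <<s range B >>.
Variable N : set (H * D).
Hypothesis mN : measurable N.
Hypothesis N0 : P [set x | Q (xsection N x) != 0] = 0.

Definition mass (V : set D) (x : H) : \bar R := S x (V `&` xsection N x).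

Let mNx x : measurable (xsection N x).
Proof. exact: measurable_xsection. Qed.

Lemma measurable_mass V : measurable V -> measurable_fun setT (mass V).
Proof.
move=> mV; rewrite (_ : mass V = fun x => S x (xsection ((setT `*` V) `&` N) x)).
  apply: measurable_fun_xsection_finite_kernel; rewrite inE.
  by apply: measurableI => //; exact: measurableX.
by apply/funext => x; rewrite /mass xsectionI in_xsectionX // inE.
Qed.

Let mass_gt (U : set H) (V : set D) (r : R) := U `&` [set x | r%:E < mass V x].

Let measurable_mass_gt U V r : measurable U -> measurable V ->
  measurable (mass_gt U V r).
Proof.
move=> mU mV; apply: emeasurable_fun_o_infty => //.
exact/measurable_funTS/measurable_mass.
Qed.

(* The quantification over [t] ranges over a countable set, so the points at
   which it fails form a null set. *)
Lemma exists_generic (U : set H) (r : R) : measurable U -> 0 < P U ->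
  exists x, [/\ U x, Q (xsection N x) = 0 &
    forall t, r%:E < mass (alg B t) x -> 0 < P (mass_gt U (alg B t) r)].
Proof.
move=> mU PU; apply: contrapT => /forallNP noU.
suff : P.-negligible U.
  by move=> /(measure_negligible mU) PU0; move: PU; rewrite PU0 ltxx.
pose F t := if P (mass_gt U (alg B t) r) == 0 then mass_gt U (alg B t) r else set0.
have mG : measurable [set x | Q (xsection N x) != 0].
  have := @emeasurable_neq _ _ _ _ (fun x => Q (xsection N x)) measurableT.
  by move=> /(_ _ 0); rewrite setTI; apply; exact: measurable_fun_xsection.
apply: (@negligibleS _ _ _ _ ([set x | Q (xsection N x) != 0] `|` \bigcup_t F t)).
  move=> x Ux; apply: contrapT => /not_orP[/negP/negPn/eqP Qx Fx].
  apply: (noU x); split=> // t tx; rewrite lt_neqAle measure_ge0 andbT eq_sym.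
  apply/negP => /eqP Pt; apply: Fx; exists t => //.
  by rewrite /F Pt eqxx.
apply: negligibleU; first by apply/negligibleP.
apply: negligible_countable_bigcup => t; rewrite /F.
case: eqP => [P0|_]; last exact: negligible_set0.
apply/negligibleP => //; apply: measurable_mass_gt => //.
exact: measurable_alg.
Qed.

Lemma split_mass (U : set H) t (r r' : R) :
  measurable U -> 0 < P U -> (r' < r)%R ->
  (forall x, U x -> r%:E < mass (alg B t) x) ->
  exists U' : bool -> set H, exists t' : bool -> GenTree.tree nat,
    alg B (t' true) `&` alg B (t' false) = set0 /\
    forall b, [/\ measurable (U' b), U' b `<=` U, 0 < P (U' b),
      alg B (t' b) `<=` alg B t & forall x, U' b x -> r'%:E < mass (alg B (t' b)) x].
Proof.
move=> mU PU rr Ur.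
(* One half is an algebra approximation of [N_x] that is [Q]-small, so that by
   Markov its complement keeps enough mass on a set of positive measure. *)
have [x [Ux Qx gx]] := exists_generic r' mU PU.
(* The Markov threshold: a set to which [S y] gives at least [r - r'] for almost every [y] in [U]
   has [Q]-measure at least this product. *)
have e0 : (0 < (r - r') * fine (P U))%R.
  by rewrite mulr_gt0 ?subr_gt0 // fine_gt0 // PU ltey_eq fin_num_measure.
have [u [Nu Que]] := alg_outer_approx BE Q (mNx x) e0.
have malg := measurable_alg BE.
have mUu : measurable (\bigcup_n alg B (u n)) by exact: bigcupT_measurable.
have Que' : Q (\bigcup_n alg B (u n)) < ((r - r') * fine (P U))%:E.
  apply: le_lt_trans Que.
  rewrite [leLHS](@measureDI _ _ _ Q _ (xsection N x)) //.
  rewrite [X in _ + X](_ : _ = 0) ?adde0 //.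
  by apply: subset_measure0 Qx => //; exact: measurableI.
have mF n : measurable (\big[setU/set0]_(i < n) alg B (u i)).
  by apply: bigsetU_measurable => i _; exact: malg.
(* The sets [alg B (u i)] cover [xsection N x], so by continuity from below finitely many of them
   keep mass above [r'] at [x]. *)
have [|||n xn] := @measure_bigcup_gt _ _ _ (S x)
    (fun n => (alg B t `&` \big[setU/set0]_(i < n) alg B (u i)) `&` xsection N x) r'%:E.
- by move=> n; do !apply: measurableI => //; exact: malg.
- move=> m n mn; apply/subsetPset; apply: setSI; apply: setIS.
  exact: (@subset_bigsetU _ (fun i => alg B (u i)) _ _ mn).
- rewrite [X in S x X](_ : _ = alg B t `&` xsection N x).
    by apply: lt_trans (Ur x Ux); rewrite lte_fin.
  apply/seteqP; split=> [y [n _ [[ty _] Ny]] //|y [ty Ny]].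
  have [n _ uy] := Nu y Ny; exists n.+1 => //.
  by rewrite /= -(bigcup_mkord _ (fun i => alg B (u i))); split=> //; split=> //; exists n => /=.
have [v vE] := alg_bigsetU B u n.
have [t1 t1E] := algI B t v.
have [v' v'E] := algC B v.
have [t0 t0E] := algI B t v'.
exists (fun b => mass_gt U (alg B (if b then t1 else t0)) r').
exists (fun b => if b then t1 else t0); split.
  by rewrite t1E t0E v'E setIACA setIid setICr setI0.
move=> b; split.
- exact: measurable_mass_gt.
- by move=> y [].
(* For the first half, genericity of [x] turns the bound at this one point into a set of positive
   measure. *)
- case: b; first by apply: gx; rewrite t1E vE.
  rewrite lt_neqAle measure_ge0 andbT; apply/eqP => U0.
  have : Q (alg B v) < ((r - r') * fine (P U))%:E.
    apply: le_lt_trans Que'; apply: le_measure; rewrite ?inE //.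
    rewrite vE -(bigcup_mkord _ (fun i => alg B (u i))).
    by move=> y [i _ uy]; exists i.
  rewrite ltNge => /negP; apply.
  (* If the second half were null, [W] would have the measure of [U]. On [W] more than [r] lies in
     [alg B t] and at most [r'] of it in [alg B t0], so [alg B v] carries at least [r - r'];
     integrating contradicts the smallness of its [Q]-measure. *)
  pose W := U `\` mass_gt U (alg B t0) r'.
  have mW : measurable W by apply: measurableD => //; exact: measurable_mass_gt.
  have PW : P W = P U.
    rewrite [RHS](@measureDI _ _ _ P _ (mass_gt U (alg B t0) r')) //; last first.
      exact: measurable_mass_gt.
    rewrite [X in _ + X](_ : _ = 0) ?adde0 //.
    apply: (@subset_measure0 _ _ _ P _ (mass_gt U (alg B t0) r')) => //.
    - by apply: measurableI => //; exact: measurable_mass_gt.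
    - exact: measurable_mass_gt.
  have -> : ((r - r') * fine (P U))%:E = \int[P]_(y in W) (r - r')%:E.
    by rewrite integral_cst // -PW EFinM fineK // fin_num_measure.
  rewrite QE //.
  apply: (@le_trans _ _ (\int[P]_(y in W) S y (alg B v))); last first.
    apply: ge0_subset_integral => //; exact: measurable_kernel.
  apply: ge0_le_integral => //.
  + by move=> y _; rewrite lee_fin subr_ge0 ltW.
  + exact/measurable_funTS/measurable_kernel.
  move=> y [Uy /not_andP[//|/negP]]; rewrite -leNgt => t0y.
  rewrite EFinB leeBlDr //; apply/ltW/(lt_le_trans (Ur y Uy)).
  rewrite addeC; apply: le_trans (leeD2r _ t0y).
  apply: (@le_trans _ _ (S y ((alg B t0 `&` xsection N y) `|` alg B v))); last first.
    by apply: measureU2 => //; exact: measurableI.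
  apply: le_measure; rewrite ?inE; [exact: measurableI| |].
    by apply: measurableU => //; exact: measurableI.
  move=> z [tz Nz]; rewrite t0E v'E.
  by have [vz|vz] := pselect (alg B v z); [right|left].
- by case: b; rewrite ?t1E ?t0E => y [].
- by move=> y [].
Qed.

End splitting.

Section cantor_scheme.
Context dH dD (H : measurableType dH) (D : measurableType dD) (R : realType).
Variables (P : probability H R) (Q : probability D R) (S : R.-pker H ~> D).
Hypothesis QE : forall V, measurable V -> Q V = \int[P]_x S x V.
Variable (B : (set D)^nat).
Hypothesis BE : @measurable dD D = <<s range B >>.
Variable N : set (H * D).
Hypothesis mN : measurable N.
Hypothesis N0 : P [set x | Q (xsection N x) != 0] = 0.
Variable K : set (set H).
Hypothesis mK : K `<=` measurable.
Hypothesis innerK : forall U, measurable U -> 0 < P U ->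
  exists C, [/\ K C, C `<=` U & 0 < P C].
Hypothesis nestedK : forall C : (set H)^nat, (forall n, K (C n)) ->
  nonincreasing_seq C -> (forall n, C n !=set0) -> \bigcap_n C n !=set0.

Local Notation state := (set H * GenTree.tree nat)%type.

(** The strict margin between [c] and [r] is consumed gradually: every split lowers [r], but the
    mass stays above the fixed [c], which therefore survives in the limit. *)
Let good (c : R) (s : state) := [/\ K s.1, 0 < P s.1 &
  exists2 r : R, (c < r)%R & forall x, s.1 x -> r%:E < mass S N (alg B s.2) x].

Let child (s s' : state) := s'.1 `<=` s.1 /\ alg B s'.2 `<=` alg B s.2.

Let exists_children c s : good c s -> exists f : bool -> state,
  alg B (f true).2 `&` alg B (f false).2 = set0 /\
  forall b, good c (f b) /\ child s (f b).
Proof.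
case: s => U t [/= KU PU [r cr Ur]].
(* The new threshold is the midpoint of [c] and [r]; shrinking each [U' b] to a member of [K] then
   restores [good]. *)
have [U' [t' [tt' UtP]]] := split_mass QE BE mN N0 (mK KU) PU (midf_lt cr).2 Ur.
have /choice[C CP] : forall b, exists C, [/\ K C, C `<=` U' b & 0 < P C].
  by move=> b; apply: innerK; case: (UtP b).
exists (fun b => (C b, t' b)); split=> // b.
have [KC CU PC] := CP b; have [_ UU _ tt U'r] := UtP b.
split; last by split=> //=; exact: subset_trans UU.
split=> //=; exists ((c + r) / 2)%R; first by rewrite (midf_lt cr).1.
by move=> x /CU; exact: U'r.
Qed.

Let exists_root : \int[P]_x S x (xsection N x) != 0 ->
  exists2 c : R, (0 < c)%R & exists s, good c s.
Proof.
move=> N1; have [t tE] := algT B.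
have mm : measurable_fun setT (mass S N setT) by exact: measurable_mass.
pose F n := [set x | (n.+1%:R^-1)%:E < mass S N setT x].
have mF n : measurable (F n).
  by rewrite /F -[X in measurable X]setTI; exact: emeasurable_fun_o_infty.
have [n Fn] : exists n, 0 < P (F n).
  apply: contrapT => /forallNP PF0; move: N1 => /negP; apply; apply/eqP.
  transitivity (\int[P]_x (cst 0 x)); last exact: integral0.
  apply: ge0_ae_eq_integral => //.
    by rewrite (_ : (fun x => _) = mass S N setT) //; apply/funext => x; rewrite /mass setTI.
  apply: (@negligibleS _ _ _ _ (\bigcup_n F n)).
    move=> x /not_implyP[_ /eqP Sx]; have {}Sx : 0 < mass S N setT x.
      by rewrite /mass setTI lt_neqAle measure_ge0 andbT eq_sym.
    have Sfin : mass S N setT x \is a fin_num.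
      by apply: finite_kernel_measure; rewrite setTI; exact: measurable_xsection.
    have /ltr_add_invr[n] : (0 < fine (mass S N setT x))%R.
      by rewrite fine_gt0 // Sx ltey_eq Sfin.
    by rewrite add0r => nx; exists n => //; rewrite /F /= -(fineK Sfin) lte_fin.
  apply: negligible_bigcup => n; apply/negligibleP => //.
  by apply/eqP; rewrite eq_le measure_ge0 andbT leNgt; apply/negP; exact: PF0.
have [C [KC CF PC]] := innerK (mF n) Fn.
(* Half of the bound that holds on [C], so that the root starts with a positive margin. *)
exists (n.+1%:R^-1 / 2)%R; first by rewrite divr_gt0 // invr_gt0.
exists (C, t); split=> //=; exists n.+1%:R^-1%R.
  by rewrite ltr_pdivrMr // ltr_pMr ?invr_gt0 // ltr1n.
by move=> x /CF; rewrite tE.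
Qed.

(** States are indexed by bit strings, and [h] records the branch that a point of [D] follows. Along
    a branch [s] the sets in [H] are nested members of [K] and share a point [x]; the sets in [D]
    all have [S x]-mass above [c], so their intersection, which lies in the fibre over [s], has mass
    at least [c]. *)
Lemma cantor_scheme : \int[P]_x S x (xsection N x) != 0 ->
  exists2 h : D -> bits, measurable_fun setT h &
    forall s, exists x V, [/\ measurable V, V `<=` h @^-1` [set s] & 0 < S x V].
Proof.
move=> /exists_root[c c0 [s0 good0]].
have /choice[step stepP] : forall s, exists f : bool -> state, good c s ->
    alg B (f true).2 `&` alg B (f false).2 = set0 /\
    forall b, good c (f b) /\ child s (f b).
  move=> s; have [/exists_children[f fP]|ngs] := pselect (good c s).
    by exists f.
  by exists (fun=> s).
pose st := foldr (fun b s => step s b) s0.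
have good_st p : good c (st p).
  by elim: p => //= b p /stepP[_ /(_ b)[]].
have child_st p b : child (st p) (st (b :: p)).
  by have [_ /(_ b)[]] := stepP _ (good_st p).
pose W p := alg B (st p).2.
have mW p : measurable (W p) by exact: measurable_alg.
have W_disj p : W (true :: p) `&` W (false :: p) = set0.
  by have [] := stepP _ (good_st p).
(* The first [n] choices of [y], latest first. A point in neither half goes to [false], so a fibre
   of [h] may be larger than the limit set of its branch. *)
pose g := fix g (y : D) n : seq bool :=
  if n is m.+1 then (y \in W (true :: g y m)) :: g y m else [::].
pose h y : bits := fun n => y \in W (true :: g y n).
have mg n p : measurable [set y | g y n = p].
  elim: n p => [|n IH] [|b p] /=.
  - by rewrite (_ : [set _ | _] = setT) //; apply/seteqP; split.
  - by rewrite (_ : [set _ | _] = set0) //; apply/seteqP; split.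
  - by rewrite (_ : [set _ | _] = set0) //; apply/seteqP; split.
  - rewrite (_ : [set _ | _] = [set y | g y n = p] `&`
        (if b then W (true :: p) else ~` W (true :: p))).
      by apply: measurableI => //; case: b => //; exact: measurableC.
    apply/seteqP; split=> y /=.
      move=> [<- <-]; split=> //; case: ifPn; first by rewrite inE.
      by rewrite notin_setE.
    by move=> [<-]; case: b => Wy; congr (_ :: _); [exact: mem_set|exact: memNset].
exists h.
  apply: measurable_bits => n.
  rewrite (_ : [set _ | _] = \bigcup_p ([set y | g y n = p] `&` W (true :: p))).
    apply: countable_bigcupT_measurable => // p; exact: measurableI.
  apply/seteqP; split=> y /=; rewrite /h.
    by rewrite inE => Wy; exists (g y n).
  by move=> [p _ [<- Wy]]; rewrite inE.
move=> s; pose path := fix path n : seq bool :=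
  if n is m.+1 then s m :: path m else [::].
have [x Ux] : \bigcap_n (st (path n)).1 !=set0.
  apply: nestedK.
  - by move=> n; case: (good_st (path n)).
  - by apply/nonincreasing_seqP => n; apply/subsetPset; case: (child_st (path n) (s n)).
  - move=> n; have [_ + _] := good_st (path n).
    by apply: contraPP => /set0P/negP/negPn/eqP ->; rewrite measure0 ltxx.
exists x, (\bigcap_n W (path n)); split.
- exact: bigcapT_measurable.
- move=> y Wy; apply/funext => n; rewrite /h.
  (* On a [false] choice, disjointness of the halves keeps [y] out of the [true] one. *)
  have hs m : g y m = path m -> (y \in W (true :: g y m)) = s m.
    move=> ->; have := Wy m.+1 Logic.I; rewrite /=.
    case: (s m) => Wm; first exact: mem_set.
    apply: memNset => Wt.
    by have : (W (true :: path m) `&` W (false :: path m)) y by []; rewrite W_disj.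
  suff gp m : g y m = path m by exact: hs.
  by elim: m => //= m IH; rewrite (hs _ IH) IH.
- apply: (@lt_le_trans _ _ c%:E); first by rewrite lte_fin.
  rewrite leNgt; apply/negP => WS.
  have [|||n] := @measure_bigcap_lt _ _ _ (S x) (fun n => W (path n)) _ _ _ _ WS.
  + by rewrite ltey_eq finite_kernel_measure.
  + by [].
  + by apply/nonincreasing_seqP => n; apply/subsetPset; case: (child_st (path n) (s n)).
  + apply/negP; rewrite -leNgt.
    have [_ _ [r cr Ur]] := good_st (path n).
    apply: (@le_trans _ _ (mass S N (W (path n)) x)).
      by apply/ltW/(lt_trans _ (Ur x (Ux n Logic.I))); rewrite lte_fin.
    apply: le_measure; rewrite ?inE //.
    by apply: measurableI => //; exact: measurable_xsection.
Qed.

End cantor_scheme.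

(** With [f] the composite of [h], [g] and [code], a Borel set [E] that serves all [S x] must
    contain [code (g s)] for every [s]: otherwise [f @^-1]
    E[would miss the set]V[charged over]s[. Then]code @^-1[E] is the range of [g], which is not
    Borel. *)
Lemma equiperfect_no_cantor_scheme dH dD (H : measurableType dH)
    (D : measurableType dD) (R : realType) (S : R.-pker H ~> D) (h : D -> bits) :
  equiperfect S -> measurable_fun setT h ->
  ~ forall s, exists x V, [/\ measurable V, V `<=` h @^-1` [set s] & 0 < S x V].
Proof.
move=> eqS mh hP; have [g mg] := nonmeasurable_range_bits; apply.
pose f y : R := code (g (h y)).
have mf : measurable_fun setT f.
  exact: measurableT_comp measurable_code (measurableT_comp mg mh).
have [E [mE Ef SE]] := eqS f mf.
suff -> : range g = code @^-1` E.
  by have := @measurable_code R measurableT _ mE; rewrite setTI.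
apply/seteqP; split=> [_ [s _ <-] /=|z /= /Ef[y _ /(can_inj codeK) <-]]; last by exists (h y).
have [x [V [mV Vh SV]]] := hP s.
have mfE : measurable (f @^-1` E) by have := mf measurableT _ mE; rewrite setTI.
apply: contrapT => gE; move: SV; apply/negP; rewrite -leNgt.
have -> : 0 = S x (~` (f @^-1` E)).
  have SxE : S x (f @^-1` E) = S x setT by exact: SE.
  have SxD : S x (~` (f @^-1` E)) = S x setT - S x (f @^-1` E).
    rewrite -setTD measureD ?setTI //.
    by rewrite ltey_eq finite_kernel_measure.
  by rewrite SxD SxE subee // finite_kernel_measure.
apply: le_measure; rewrite ?inE //; first exact: measurableC.
by move=> y /Vh hy; rewrite /= /f hy.
Qed.

(** * The posterior kernel *)

Section joint_measure.
Context dH dD (H : measurableType dH) (D : measurableType dD) (R : realType).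
Variables (P : probability H R) (S : R.-pker H ~> D).

Definition joint (C : set (H * D)) : \bar R := \int[P]_x S x (xsection C x).

Lemma measurable_kernel_xsection (C : set (H * D)) :
  measurable C -> measurable_fun setT (fun x => S x (xsection C x)).
Proof. by move=> mC; apply: measurable_fun_xsection_finite_kernel; rewrite inE. Qed.

Let joint0 : joint set0 = 0.
Proof. by rewrite /joint integral0_eq // => x _; rewrite xsection0. Qed.

Let joint_ge0 C : 0 <= joint C.
Proof. exact: integral_ge0. Qed.

Let joint_sigma_additive : semi_sigma_additive joint.
Proof.
move=> F mF tF mUF.
rewrite [X in _ --> X](_ : _ = \sum_(n <oo) joint (F n)).
  by apply/cvg_closeP; split; [exact: is_cvg_nneseries|rewrite closeE].
rewrite -integral_nneseries //; last by move=> n; exact: measurable_kernel_xsection.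
apply: eq_integral => x _; apply/esym/cvg_lim => //=; rewrite xsection_bigcup.
apply: (measure_sigma_additive _ (trivIset_xsection tF)) => ?.
exact: measurable_xsection.
Qed.

HB.instance Definition _ := isMeasure.Build _ _ _ joint
  joint0 joint_ge0 joint_sigma_additive.

Let joint_setT : joint setT = 1.
Proof.
rewrite -(probability_setT P) -[RHS]mul1e -integral_cst //.
by apply: eq_integral => x _; rewrite -setXTT in_xsectionX ?inE // prob_kernel.
Qed.

HB.instance Definition _ := Measure_isProbability.Build _ _ _ joint joint_setT.

Lemma jointX (A : set H) (V : set D) : measurable A -> measurable V ->
  joint (A `*` V) = \int[P]_(x in A) S x V.
Proof.
move=> mA mV; rewrite [RHS]integral_mkcond; apply: eq_integral => x _.
rewrite patchE; case: ifPn => xA; first by rewrite in_xsectionX.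
by rewrite notin_xsectionX // measure0.
Qed.

End joint_measure.

Section density_kernel.
Context dH dD (H : measurableType dH) (D : measurableType dD) (R : realType).
Variables (mu : {sigma_finite_measure set H -> \bar R}) (f : H * D -> \bar R).
Hypotheses (f0 : forall z, 0 <= f z) (mf : measurable_fun setT f).

Definition density (y : D) (A : set H) : \bar R := \int[mu]_(x in A) f (x, y).

Let mfy y : measurable_fun setT (fun x => f (x, y)).
Proof. exact: measurable_fun_pair1. Qed.

Let density0 y : density y set0 = 0.
Proof. exact: integral_set0. Qed.

Let density_ge0 y A : 0 <= density y A.
Proof. exact: integral_ge0. Qed.

Let density_sigma_additive y : semi_sigma_additive (density y).
Proof. by apply: semi_sigma_additive_nng_induced. Qed.

HB.instance Definition _ y := isMeasure.Build _ _ _ (density y)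
  (density0 y) (density_ge0 y) (@density_sigma_additive y).

Definition density_kernel : D -> {measure set H -> \bar R} := density.

(** With the restriction to [A] moved into the integrand, measurability in [y] is an instance of
    Tonelli. *)
Lemma density_patch (A : set H) y :
  density y A = \int[mu]_x (f \_ (A `*` setT)) (x, y).
Proof.
rewrite /density integral_mkcond; apply: eq_integral => x _.
by rewrite !patchE in_setX /= in_setT andbT.
Qed.

Let measurable_patch (C : set (H * D)) : measurable C -> measurable_fun setT (f \_ C).
Proof. by move=> mC; apply/(measurable_restrictT _ mC); exact: measurable_funTS. Qed.

Let patch_ge0 (C : set (H * D)) z : 0 <= (f \_ C) z.
Proof. by rewrite patchE; case: ifPn. Qed.

Let measurable_density A : measurable A -> measurable_fun setT (density_kernel ^~ A).
Proof.
move=> mA; rewrite (_ : density_kernel ^~ A =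
    fubini_G mu (f \_ (A `*` setT))); last by apply/funext => y; exact: density_patch.
apply: measurable_fun_fubini_tonelli_G => //.
by apply: measurable_patch; exact: measurableX.
Qed.

HB.instance Definition _ := isKernel.Build _ _ _ _ _ density_kernel measurable_density.

Lemma integral_density (nu : {sigma_finite_measure set D -> \bar R}) A V :
  measurable A -> measurable V ->
  \int[nu]_(y in V) density y A = \int[mu \x nu]_(z in A `*` V) f z.
Proof.
move=> mA mV; have mAV : measurable (A `*` V) by exact: measurableX.
rewrite [RHS]integral_mkcond fubini_tonelli2 //; last exact: measurable_patch.
rewrite integral_mkcond; apply: eq_integral => y _; rewrite patchE.
case: ifPn => yV.
  rewrite /density integral_mkcond; apply: eq_integral => x _.
  by rewrite !patchE in_setX /= yV andbT.
rewrite /fubini_G integral0_eq // => x _.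
by rewrite patchE in_setX /= (negbTE yV) andbF.
Qed.

End density_kernel.

Lemma posterior_kernel dH dD (H : measurableType dH) (D : measurableType dD)
    (R : realType) (P : probability H R) (Q : probability D R) (S : R.-pker H ~> D) :
  (forall V, measurable V -> Q V = \int[P]_x S x V) ->
  joint P S `<< P \x Q ->
  exists I : R.-pker D ~> H,
    (forall y A, measurable A -> P A = 0 -> I y A = 0) /\
    forall A V, measurable A -> measurable V ->
      \int[P]_(x in A) S x V = \int[Q]_(y in V) I y A.
Proof.
pose PQ : probability (H * D)%type R := P \x Q.
move=> QE /(@radon_nikodym_sigma_finite _ _ _ PQ (joint P S))[f [f0 _ intf fE]].
have mf : measurable_fun setT f by exact: measurable_int intf.
pose k := density_kernel P f0 mf.
have kE A V : measurable A -> measurable V ->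
    \int[P]_(x in A) S x V = \int[Q]_(y in V) k y A.
  move=> mA mV; rewrite -jointX // fE; last exact: measurableX.
  exact/esym/integral_density.
(* Both functions integrate to [Q V] over every [V], so the unnormalized kernel has total mass 1 for
   [Q]-almost every [y]. *)
have k1 : ae_eq Q setT (cst 1) (k ^~ setT).
  apply: integral_ae_eq => //.
  - exact: finite_measure_integrable_cst.
  - exact: measurable_kernel.
  - by move=> V _ mV; rewrite -kE // -QE // integral_cst // mul1e.
(* Where the total mass is zero or infinite, the normalization falls back on [P] itself; hence
   absolute continuity with respect to [P] holds for every [y], not just almost every one. *)
exists (knormalize k P); split.
  move=> y A mA PA; have kA : k y A = 0.
    by apply: null_set_integral => //; exact/measurable_funTS/measurable_fun_pair1.
  by rewrite /= /mnormalize; case: ifP => // _; rewrite kA mul0e.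
move=> A V mA mV; rewrite kE //; apply: ge0_ae_eq_integral => //.
- exact/measurable_funTS/measurable_kernel.
- exact/measurable_funTS/measurable_kernel.
apply: (ae_eq_subset (@subsetT _ V)).
apply: filterS k1 => y /(_ Logic.I) ky1 _; have ky : k y setT = 1 by exact/esym.
change (k y A = mnormalize (k y) P A).
by rewrite /mnormalize ky onee_eq0 /= invr1 mule1.
Qed.

Lemma equiperfect_joint_dominates dH dD (H : measurableType dH)
    (D : measurableType dD) (R : realType) (P : probability H R)
    (Q : probability D R) (S : R.-pker H ~> D) :
  countably_generated H -> countably_generated D ->
  (forall f : H -> R, measurable_fun setT f -> exists E : set R,
    [/\ measurable E, E `<=` range f & P (f @^-1` E) = P setT]) ->
  equiperfect S ->
  (forall V, measurable V -> Q V = \int[P]_x S x V) ->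
  joint P S `<< P \x Q.
Proof.
move=> cgH /countably_generated_seq[B BE] perfP eqS QE.
apply/null_content_dominatesP => N mN N0; apply/eqP; apply: contraPT isT => jN _.
have mQN : measurable_fun setT (fun x => Q (xsection N x)).
  exact: measurable_fun_xsection.
(* The product measure of [N] is the integral of the nonnegative function [Q (xsection N x)], which
   therefore vanishes almost everywhere. *)
have PN0 : P [set x | Q (xsection N x) != 0] = 0.
  have : \int[P]_x `|Q (xsection N x)| = 0.
    by rewrite -[RHS]N0; apply: eq_integral => x _; rewrite gee0_abs.
  move=> /ae_eq_integral_abs-/(_ measurableT mQN) QN.
  apply: measure_negligible.
    have := emeasurable_neq measurableT mQN 0.
    by rewrite setTI.
  apply: negligibleS QN => x Qx /(_ Logic.I) Qx0.
  by move: Qx; rewrite /= Qx0 eqxx.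
have [K [mK innerK nestedK]] := perfect_compact_class cgH perfP.
have [h mh hP] := cantor_scheme QE BE mN PN0 mK innerK nestedK jN.
exact: equiperfect_no_cantor_scheme eqS mh hP.
Qed.

(** * Uniqueness almost everywhere *)

Lemma kernel_ae_unique dH dD (H : measurableType dH) (D : measurableType dD)
    (R : realType) (Q : probability D R) (I I' : R.-pker D ~> H) :
  countably_generated H ->
  (forall A V, measurable A -> measurable V ->
    \int[Q]_(y in V) I y A = \int[Q]_(y in V) I' y A) ->
  measurable [set y | ~ eq_on_measurable (I y) (I' y)] /\
  Q [set y | ~ eq_on_measurable (I y) (I' y)] = 0.
Proof.
move=> /countably_generated_seq[B BE] II'.
have mB t : measurable (alg B t) by exact: measurable_alg.
(* Countably many test sets give a single exceptional null set. *)
pose F t := [set y | I y (alg B t) != I' y (alg B t)].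
have mF t : measurable (F t).
  rewrite /F -[X in measurable X]setTI.
  by apply: measurable_neqe => //; exact: measurable_kernel.
have QF t : Q.-negligible (F t).
  have : ae_eq Q setT (I ^~ (alg B t)) (I' ^~ (alg B t)).
    apply: integral_ae_eq => //; last by move=> V _ mV; exact: II'.
    - apply: (le_integrable measurableT _ _ (finite_measure_integrable_cst Q 1 measurableT)).
        exact: measurable_kernel.
      move=> y _; rewrite gee0_abs //= normr1 -(prob_kernel (s := I) y).
      by apply: le_measure; rewrite ?inE.
    - exact: measurable_kernel.
  by apply: negligibleS => y /eqP Fy /(_ Logic.I).
(* The algebra generates the sigma-algebra and is stable under intersection, so measures that agree
   on it agree everywhere. The disagreement set is thus a countable union of measurable sets. *)
have -> : [set y | ~ eq_on_measurable (I y) (I' y)] = \bigcup_t F t.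
  apply/seteqP; split=> y; last first.
    by move=> [t _ /eqP Ft] /= h; apply: Ft; exact: h.
  apply: contra_notP => noF A mA.
  apply: (@measure_unique _ R H (range (alg B)) (fun=> setT)) mA => //.
  - apply/seteqP; split.
      rewrite BE; apply: sub_sigma_algebra2 => _ [n _ <-].
      by exists (GenTree.Leaf n).
    apply: smallest_sub; first exact: sigma_algebra_measurable.
    by move=> _ [t _ <-].
  - by move=> _ _ [t _ <-] [t' _ <-]; have [u uE] := algI B t t'; exists u.
  - by move=> _; have [t tE] := algT B; exists t.
  - by rewrite bigcup_const //; exists 0%N.
  - move=> _ [t _ <-]; apply: contrapT => /eqP It; apply: noF; by exists t.
  - by move=> _; rewrite prob_kernel ltry.
split; first exact: countable_bigcupT_measurable.
apply: measure_negligible; first exact: countable_bigcupT_measurable.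
exact: negligible_countable_bigcup.
Qed.

Section kernel_prob.
Context (R : realType) d d' (X : measurableType d) (Y : measurableType d').
Variables (k : R.-pker X ~> Y) (x : X).

Definition kernel_prob : set Y -> \bar R := k x.

HB.instance Definition _ := Measure.on kernel_prob.
HB.instance Definition _ :=
  Measure_isProbability.Build _ _ _ kernel_prob (prob_kernel x).

End kernel_prob.

Theorem theorem4p1 (R : realType) (dH dD : measure_display)
    (H : measurableType dH) (D : measurableType dD)
    (cgH : countably_generated H) (cgD : countably_generated D)
    (PH : perfect_arrow R unit H) (S : perfect_arrow R H D) :
  (exists I : perfect_arrow R D H, inference_map PH S I) /\
  (forall I I' : perfect_arrow R D H,
     inference_map PH S I -> inference_map PH S I' ->
     measurable [set y | ~ eq_on_measurable (I y) (I' y)] /\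
     perfect_comp PH S tt [set y | ~ eq_on_measurable (I y) (I' y)] = 0).
Proof.
pose P : probability H R := kernel_prob PH tt.
pose Q : probability D R := kernel_prob (perfect_comp PH S) tt.
split; last first.
  move=> I I' HI HI'; apply: (@kernel_ae_unique _ _ H D R Q) => // A V mA mV.
  by rewrite -[LHS]HI // -[RHS]HI'.
have perfP (f : H -> R) : measurable_fun setT f -> exists E : set R,
    [/\ measurable E, E `<=` range f & P (f @^-1` E) = P setT].
  by move=> /(arrow_equiperfect PH)[E [mE Ef PE]]; exists E; split=> //; exact: PE.
have QE V : measurable V -> Q V = \int[P]_x S x V by [].
have PQ := equiperfect_joint_dominates cgH cgD perfP (arrow_equiperfect S) QE.
have [I [IP IE]] := posterior_kernel QE PQ.
have eqI : equiperfect I.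
  move=> f mf; have [E [mE Ef PE]] := perfP f mf; exists E; split=> // y.
  have mfE : measurable (f @^-1` E) by rewrite -[X in measurable X]setTI; exact: mf.
  have PC : P (~` (f @^-1` E)) = 0.
    have -> : P (~` (f @^-1` E)) = 1 - P (f @^-1` E) by exact: probability_setC.
    by rewrite PE probability_setT subee.
  have IC := IP y _ (measurableC mfE) PC.
  have IT : I y setT = I y (setT `\` f @^-1` E) + I y (setT `&` f @^-1` E).
    exact: measureDI.
  by rewrite IT setTD setTI IC add0e.
exists (PerfectArrow eqI) => A V mA mV; exact: IE.
Qed.
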